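(* Let $n\ge 3$ be an integer, and let $P_n$ be the path on $n$ vertices. Write $n-2=\alpha_n+3k_n$ with $k_n$ a nonnegative integer and $\alpha_n\in\{0,1,2\}$ (so $\alpha_n\equiv n-2\pmod 3$). Then \[ \psi(P_n)=2^{n+1}\left(\frac{1-8^{-(k_n+1)}}{7}\right)+\left\lfloor\frac{\alpha_n}{2}\right\rfloor . \]
   Context: All graphs are finite, simple and connected. A configuration of pebbles on a graph $G$ is a function $C:V(G)\to\mathbb{N}\cup\{0\}$, where $C(v)$ is the number of (indistinguishable) pebbles on $v$; its number of pebbles is $\sum_{v\in V(G)} C(v)$. A pebbling move removes two pebbles from some vertex $u$ having at least two pebbles and places one pebble on a vertex adjacent to $u$ (the other pebble is discarded). A set $D\subseteq V(G)$ is a dominating set if every vertex of $G$ is in $D$ or adjacent to an element of $D$. The domination cover pebbling number $\psi(G)$ is the minimum number of pebbles such that every initial configuration with that number of pebbles on $V(G)$ can be transformed, by some (possibly empty) finite sequence of pebbling moves, into a configuration in which the set of vertices containing at least one pebble is a dominating set of $G$ (the dominating set may depend on the initial configuration and need not be a minimum dominating set). *)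

(* Defs.v *)
From Stdlib Require Import Relation_Operators.
From mathcomp Require Import all_boot all_order all_algebra.

Set Implicit Arguments.
Unset Strict Implicit.
Unset Printing Implicit Defensive.

Record graph := Graph {
  vertex :> finType;
  adj : rel vertex;
  adj_sym : symmetric adj;
  adj_irrefl : irreflexive adj;
  adj_connected : forall u v, connect adj u v
}.

Definition path_adj (n : nat) : rel 'I_n :=
  fun i j => (i.+1 == j :> nat) || (j.+1 == i :> nat).

Lemma path_adj_sym n : symmetric (@path_adj n).
Proof. by move=> i j; rewrite /path_adj orbC. Qed.

Lemma path_adj_irrefl n : irreflexive (@path_adj n).
Proof. by move=> i; rewrite /path_adj orbb; apply/eqP => /esym/n_Sn. Qed.

Lemma path_adj_connected n (i j : 'I_n) : connect (@path_adj n) i j.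
Proof.
have up (k : nat) (i0 j0 : 'I_n) : i0 + k = j0 -> connect (@path_adj n) i0 j0.
  elim: k j0 => [|k IHk] j0.
    by rewrite addn0 => /val_inj ->; exact: connect0.
  rewrite addnS => e.
  have lt_k : i0 + k < n by apply: ltn_trans (ltn_ord j0); rewrite -e.
  apply: connect_trans (IHk (Ordinal lt_k) erefl) (connect1 _).
  by rewrite /path_adj /= e eqxx.
have [le_ij|/ltnW le_ji] := leqP i j; first by apply: (up (j - i)); rewrite subnKC.
by rewrite (sym_connect_sym (@path_adj_sym n)); apply: (up (i - j)); rewrite subnKC.
Qed.

Definition path_graph (n : nat) : graph :=
  @Graph 'I_n (@path_adj n) (@path_adj_sym n) (@path_adj_irrefl n)
    (@path_adj_connected n).

Section Pebbling.

Variable G : graph.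

Definition configuration := {ffun G -> nat}.

Definition num_pebbles (C : configuration) : nat := \sum_(v : G) C v.

(* The subtraction is never truncated and [u != v], since [adj] is
   irreflexive and [u] holds at least two pebbles. *)
Definition pebbling_move (C C' : configuration) : Prop :=
  exists u v : G, [/\ adj u v, 2 <= C u &
    C' = [ffun x => C x - (if x == u then 2 else 0)
                    + (if x == v then 1 else 0)]].

Definition reachable : configuration -> configuration -> Prop :=
  clos_refl_trans configuration pebbling_move.

Definition dominating (D : {set G}) : bool :=
  [forall v, (v \in D) || [exists u in D, adj v u]].

Definition support_set (C : configuration) : {set G} := [set v | 0 < C v].

Definition coverable (C : configuration) : Prop :=
  exists C', reachable C C' /\ dominating (support_set C').

Definition always_coverable (m : nat) : Prop :=
  forall C, num_pebbles C = m -> coverable C.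

(* [is_psi m] means that the minimum defining psi(G) exists and equals [m]. *)
Definition is_psi (m : nat) : Prop :=
  always_coverable m /\ (forall m', always_coverable m' -> m <= m').

Lemma is_psi_unique m1 m2 : is_psi m1 -> is_psi m2 -> m1 = m2.
Proof.
by move=> [a1 l1] [a2 l2]; apply/eqP; rewrite eqn_leq l1 ?l2.
Qed.

End Pebbling.

(* Main.v *)
Require Import Defs.
From mathcomp Require Import all_boot all_order all_algebra.
From mathcomp Require Import zify ring.
From Stdlib Require Import Relation_Operators.
Import GRing.Theory Num.Theory.

(** The value psi(P_n) obeys a recurrence, psi(P_(m+3)) = 2^(m+1) + psi(P_m),
    with initial values 0, 1, 1; the closed formula is the resulting geometric
    sum of ratio 8, the floor being the value psi(P_1) = 1 left over when
    n = 1 modulo 3.  The recurrence reflects the fact that the cheapest way to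
    dominate the three vertices at one end of a path, from pebbles at the other
    end, is to put one pebble on the middle one of the three, at distance m+1
    from the opposite end.

    Upper bound ([seq_coverable_psi]), by induction on the length in steps of
    three.  Two pebbles suffice to dominate a path with three vertices
    ([seq_coverable3]).  If the first m vertices of P_(m+3) carry at least
    psi(P_m) pebbles, then the missing pebbles, at most two, can be brought to
    the last three vertices at a cost of at most 2^m each ([carry]), the budget
    2^(m+1) pays for this, and the two pieces are dominated separately
    ([seq_coverable_peel]).  By reflection the same works if the last m
    vertices carry at least psi(P_m) pebbles.  For m at least 3 one of the two
    ends always does, since 2 psi(P_m) is at most psi(P_(m+3)); for m = 1 and
    m = 2 the remaining configurations have all their pebbles on the inner
    vertices and are treated by hand.

    Lower bound ([psi_path_lower]).  Weigh a pebble at distance d from the last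
    vertex by 2^d.  No move increases the total weight, so a dominating
    configuration reached from m pebbles on the last vertex has weight at most
    m, whereas every dominating configuration has weight at least psi(P_n)
    ([dominated_weight]).

    The combinatorics takes place on sequences of numbers, for which cutting
    and reflecting a path are concatenation and reversal. *)

Local Open Scope nat_scope.

(** * The recurrence *)

Fixpoint psi_path (n : nat) : nat :=
  match n with
  | 0 => 0
  | m.+3 => 2 ^ m.+1 + psi_path m
  | _ => 1
  end.

Lemma psi_path_le n : psi_path n <= 2 ^ n.
Proof.
elim/ltn_ind: n => -[|[|[|m]]] // IH.
rewrite /= !expnS; have := IH m (leqW (leqW (leqnn m.+1))).
lia.
Qed.

(** * Pebbling on sequences *)

(** The invariant [P] is for maps that respect the relation only on part of
    their domain, such as the sequences of a given length. *)
Lemma clos_map (A B : Type) (R : A -> A -> Prop) (R' : B -> B -> Prop)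
    (g : A -> B) (P : A -> Prop) :
  (forall x y, P x -> R x y -> P y /\ R' (g x) (g y)) ->
  forall x y, clos_refl_trans A R x y -> P x ->
    P y /\ clos_refl_trans B R' (g x) (g y).
Proof.
move=> h x y; elim=> [{}x {}y Rxy Px|{}x Px|{}x {}y z _ IH1 _ IH2 Px].
- by have [Py R'xy] := h _ _ Px Rxy; split=> //; apply: rt_step.
- by split=> //; apply: rt_refl.
- have [Py xy] := IH1 Px; have [Pz yz] := IH2 Py.
  by split=> //; apply: rt_trans xy yz.
Qed.

Variant step : seq nat -> seq nat -> Prop :=
| step_right p a b q : step (p ++ a.+2 :: b :: q) (p ++ a :: b.+1 :: q)
| step_left p a b q : step (p ++ b :: a.+2 :: q) (p ++ b.+1 :: a :: q).

Definition reach : seq nat -> seq nat -> Prop := clos_refl_trans (seq nat) step.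

Lemma step_size s t : step s t -> size t = size s.
Proof. by case=> *; rewrite !size_cat. Qed.

Lemma reach_size s t : reach s t -> size t = size s.
Proof.
elim=> // [{}s {}t /step_size //|{}s {}t u _ e1 _ e2]; exact: etrans e2 e1.
Qed.

Lemma reach_map (g : seq nat -> seq nat) :
  (forall s t, step s t -> step (g s) (g t)) ->
  forall s t, reach s t -> reach (g s) (g t).
Proof.
move=> h s t st.
by have [] := clos_map _ _ step step g (fun=> True)
  (fun x y _ xy => conj I (h x y xy)) s t st I.
Qed.

Lemma reach_catr u s t : reach s t -> reach (s ++ u) (t ++ u).
Proof.
apply: (reach_map (fun s => s ++ u)) => {}s {}t [] p a b q.
all: by rewrite -!catA /=; constructor.
Qed.

Lemma reach_catl u s t : reach s t -> reach (u ++ s) (u ++ t).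
Proof.
by apply: reach_map => {}s {}t [] p a b q; rewrite !catA; constructor.
Qed.

Lemma reach_rev s t : reach s t -> reach (rev s) (rev t).
Proof.
apply: reach_map => {}s {}t [] p a b q.
all: by rewrite !rev_cat !rev_cons -!cats1 -!catA /=; constructor.
Qed.

(** The entry to the left of position [i] is the [i]-th entry of [0 :: s]; thus
    a missing neighbour at either end counts as an empty vertex. *)
Definition dominated (s : seq nat) : Prop :=
  forall i, i < size s -> 0 < nth 0 (0 :: s) i + nth 0 s i + nth 0 s i.+1.

Lemma dominated_cat s t : dominated s -> dominated t -> dominated (s ++ t).
Proof.
move=> ds dt i; rewrite size_cat => lt_i.
have [lt_is|le_si] := ltnP i (size s).
  have -> : nth 0 (0 :: s ++ t) i = nth 0 (0 :: s) i.
    by rewrite -cat_cons nth_cat /= ltnS (ltnW lt_is).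
  have -> : nth 0 (s ++ t) i = nth 0 s i by rewrite nth_cat lt_is.
  have : nth 0 s i.+1 <= nth 0 (s ++ t) i.+1.
    by rewrite nth_cat; case: ltnP => // h; rewrite nth_default.
  by have := ds i lt_is; lia.
have := dt (i - size s) ltac:(lia).
have -> : nth 0 (s ++ t) i = nth 0 t (i - size s).
  by rewrite nth_cat ltnNge le_si.
have -> : nth 0 (s ++ t) i.+1 = nth 0 t (i - size s).+1.
  by rewrite nth_cat ltnNge leqW //= subSn.
have : nth 0 (0 :: t) (i - size s) <= nth 0 (0 :: s ++ t) i.
  have [le_is|lt_si] := leqP i (size s).
    by have -> : i - size s = 0 by lia.
  rewrite -cat_cons nth_cat /= ltnNge lt_si /= subnS.
  by rewrite -[i - size s]prednK ?subn_gt0.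
lia.
Qed.

Lemma dominated_rev s : dominated s -> dominated (rev s).
Proof.
move=> ds i; rewrite size_rev => lt_i.
have := ds (size s - i.+1) ltac:(lia).
rewrite nth_rev // -subSn // subSS.
have -> : nth 0 (0 :: s) (size s - i.+1) = nth 0 (rev s) i.+1.
  have [lt_i1|le_i1] := ltnP i.+1 (size s).
    by rewrite nth_rev // -[X in nth 0 _ X = _]prednK /=; [congr nth; lia|lia].
  by rewrite [RHS]nth_default ?size_rev //; have -> : size s - i.+1 = 0 by lia.
have -> : nth 0 (0 :: rev s) i = nth 0 s (size s - i).
  case: i lt_i => [|i] lt_i /=; first by rewrite subn0 nth_default.
  by rewrite nth_rev //; lia.
lia.
Qed.

Definition seq_coverable (s : seq nat) : Prop :=
  exists t, reach s t /\ dominated t.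

Lemma seq_coverable_reach s t : reach s t -> seq_coverable t -> seq_coverable s.
Proof.
by move=> st [u [tu du]]; exists u; split=> //; apply: rt_trans st tu.
Qed.

Lemma seq_coverable_cat s t :
  seq_coverable s -> seq_coverable t -> seq_coverable (s ++ t).
Proof.
move=> [s' [ss' ds']] [t' [tt' dt']]; exists (s' ++ t'); split.
  by apply: rt_trans (reach_catr _ _ _ ss') (reach_catl _ _ _ tt').
exact: dominated_cat.
Qed.

Lemma seq_coverable_rev s : seq_coverable (rev s) -> seq_coverable s.
Proof.
move=> [t [st dt]]; exists (rev t); split; last exact: dominated_rev.
by rewrite -[s]revK; apply: reach_rev.
Qed.

Lemma reach_right_iter j a b q : reach (a + j.*2 :: b :: q) (a :: b + j :: q).
Proof.
elim: j b => [|j IH] b; first by rewrite double0 !addn0; apply: rt_refl.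
rewrite doubleS addnS addnS -addSnnS; apply: rt_trans (IH b.+1).
by apply: rt_step; apply: (step_right [::]).
Qed.

(** * Transporting pebbles *)

(** This is the bound 2^d for the pebbling number of a path of length d, with
    the cost made explicit: one pebble gets past the end of [s] at the expense
    of at most [2 ^ size s] pebbles, and all the others remain available.  The
    first vertex only has to supply what the rest of [s] lacks to reach half of
    that amount, so that nothing is moved needlessly. *)
Lemma carry s x u : 2 ^ size s <= sumn s ->
  exists s', [/\ size s' = size s, sumn s <= sumn s' + 2 ^ size s
    & reach (s ++ x :: u) (s' ++ x.+1 :: u)].
Proof.
move: {2}(size s) (erefl (size s)) => m.
elim: m s => [|m IH] [|a s] //= [es]; rewrite es expnS => le_s.
have [le_s'|lt_s] := leqP (2 ^ m) (sumn s).
  have [] := IH s es; rewrite es // => s' [e1 e2 e3]; exists (a :: s').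
  split=> /=; [by rewrite e1 | lia | exact: (reach_catl [:: a] _ _ e3)].
(* [j] moves out of the first vertex give the rest exactly [2 ^ m] pebbles; they
   are affordable because [2 * j = 2 ^ m.+1 - 2 * sumn s <= a - sumn s]. *)
pose j := 2 ^ m - sumn s.
have ej : a = a - j.*2 + j.*2 by rewrite /j; lia.
have push b q : reach (a :: b :: q) (a - j.*2 :: b + j :: q).
  by rewrite {1}ej; apply: reach_right_iter.
case: s => [|b s] in es le_s lt_s j ej push *.
  have j1 : j = 1 by rewrite /j -es.
  rewrite {}j1 in push; rewrite -es /= in le_s *.
  exists [:: a - 2]; split=> //=; first by lia.
  by rewrite -[x.+1]addn1; apply: push.
have sum_m : sumn (b + j :: s) = 2 ^ m by move: lt_s; rewrite /j /=; lia.
have [] := IH (b + j :: s) es; rewrite /= in es sum_m *; rewrite es ?sum_m //.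
move=> s' [e1 e2 e3]; exists (a - j.*2 :: s').
split=> /=; first by rewrite e1.
  by move: le_s lt_s; rewrite /j /=; lia.
apply: rt_trans (push b _) (reach_catl [:: a - j.*2] _ _ e3).
Qed.

(** * The upper bound *)

(** A pebble in the centre dominates everything.  If the centre is empty, an
    end holding two pebbles can supply it; otherwise both ends are occupied. *)
Lemma seq_coverable3 a b c : 2 <= a + b + c -> seq_coverable [:: a; b; c].
Proof.
move=> le2.
have centre x y z : 0 < y -> dominated [:: x; y; z].
  by move=> y0 [|[|[|i]]] //=; lia.
case: b => [|b] in le2 *; last first.
  by exists [:: a; b.+1; c]; split; [apply: rt_refl | apply: centre].
have [a_ge2|a_lt2] := leqP 2 a.
  have -> : a = (a - 2).+2 by lia.
  exists [:: a - 2; 1; c]; split; last exact: centre.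
  by apply: rt_step; apply: (step_right [::]).
have [c_ge2|c_lt2] := leqP 2 c.
  have -> : c = (c - 2).+2 by lia.
  exists [:: a; 1; c - 2]; split; last exact: centre.
  by apply: rt_step; apply: (step_left [:: a]).
exists [:: a; 0; c]; split; first exact: rt_refl.
by case=> [|[|[|i]]] //=; lia.
Qed.

(** The hypothesis reserves [2 ^ m] pebbles for each of the pebbles that the
    last three vertices lack: a use of [carry] frees one such reserve and lowers
    [sumn s] by no more than that, hence preserves the inequality. *)
Lemma seq_coverable_peel m s a b c :
  (forall t, size t = m -> psi_path m <= sumn t -> seq_coverable t) ->
  size s = m -> psi_path m + (2 - (a + b + c)) * 2 ^ m <= sumn s ->
  seq_coverable (s ++ [:: a; b; c]).
Proof.
move=> IH; have [k] := ubnP (2 - (a + b + c)).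
elim: k s a => // k IHk s a lt_k es le_s.
have [le2|lt2] := leqP 2 (a + b + c).
  apply: seq_coverable_cat (seq_coverable3 _ _ _ le2); apply: IH => //; lia.
have [|s' []] := carry s a [:: b; c]; rewrite es; first by nia.
move=> es' le_s' ss'; apply: (seq_coverable_reach _ _ ss').
by apply: IHk => //; nia.
Qed.

Lemma sumn_take_le s i j : i <= j -> sumn (take i s) <= sumn (take j s).
Proof.
move=> le_ij; rewrite -(cat_take_drop i (take j s)) sumn_cat take_takel //.
exact: leq_addr.
Qed.

Lemma sumn_take_drop s i : sumn s = sumn (take i s) + sumn (drop i s).
Proof. by rewrite -sumn_cat cat_take_drop. Qed.

Lemma seq_coverable_psi s : psi_path (size s) <= sumn s -> seq_coverable s.
Proof.
move: {-1}(size s) (erefl (size s)) => n.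
elim/ltn_ind: n s => -[|[|[|m]]] IH s es le_s.
- by case: s es le_s => // _ _; exists [::]; split=> //; apply: rt_refl.
- case: s es le_s => // x [] //= _ le_s.
  by exists [:: x]; split; [apply: rt_refl | case=> //=; lia].
- case: s es le_s => // x [|y []] //= _ le_s.
  by exists [:: x; y]; split; [apply: rt_refl | case=> [|[]] //=; lia].
have IHm := IH m (leqW (leqW (leqnn m.+1))).
(* With two pebbles on the last three vertices nothing has to be carried.  With
   one, the others number at least [2 ^ m.+1 + psi_path m - 1], enough to carry
   one; with none, at least [2 ^ m.+1 + psi_path m], enough to carry two. *)
have peel t : size t = m.+3 -> psi_path m.+3 <= sumn t ->
    psi_path m <= sumn (take m t) -> seq_coverable t.
  move=> et le_t le_take; rewrite -(cat_take_drop m t).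
  have : size (drop m t) = 3 by rewrite size_drop et; lia.
  move: le_t; rewrite (sumn_take_drop t m).
  case: (drop m t) => [|a [|b [|c []]]] //= le_t _.
  apply: (seq_coverable_peel m); rewrite //= ?size_takel ?et //; first by lia.
  have m_gt0 : 0 < 2 ^ m by rewrite expn_gt0.
  by move: le_t; rewrite expnS; nia.
have [le_l|lt_l] := leqP (psi_path m) (sumn (take m s)); first exact: peel.
have [le_r|lt_r] := leqP (psi_path m) (sumn (drop 3 s)).
  apply: seq_coverable_rev; apply: peel.
  - by rewrite size_rev.
  - by rewrite sumn_rev.
  - by rewrite take_rev es sumn_rev; have -> : m.+3 - m = 3 by lia.
(* From here on neither end holds [psi_path m] pebbles. *)
case: m => [|[|[|m]]] in IH es le_s IHm peel lt_l lt_r *.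
- by [].
(* Four vertices: both end vertices are empty. *)
- case: s es le_s lt_l lt_r => // a [|b [|c [|d []]]] //= _ le_s lt_l lt_r.
  have -> : a = 0 by lia.
  have -> : d = 0 by lia.
  have {le_s} le_bc : 5 <= b + c by lia.
  case: b c le_bc => [|b] [|c] // le_bc.
  + have -> : c = c.-1.+1 by lia.
    exists [:: 0; 1; c.-1; 0]; split; last by case=> [|[|[|[|i]]]] //=; lia.
    by apply: rt_step; apply: (step_left [:: 0]).
  + have -> : b = b.-1.+1 by lia.
    exists [:: 0; b.-1; 1; 0]; split; last by case=> [|[|[|[|i]]]] //=; lia.
    by apply: rt_step; apply: (step_right [:: 0]).
  + exists [:: 0; b.+1; c.+1; 0].
    by split; [apply: rt_refl | case=> [|[|[|[|i]]]]].
(* Five vertices: all the pebbles are on the central one. *)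
- case: s es le_s lt_l lt_r => // a [|b [|c [|d [|e []]]]] //= _ le_s lt_l lt_r.
  have [-> [-> [-> ->]]] : a = 0 /\ b = 0 /\ d = 0 /\ e = 0 by lia.
  have -> : c = (c - 4).+4 by lia.
  exists [:: 0; 1; c - 4; 1; 0]; split; last by case=> [|[|[|[|[|i]]]]] //=; lia.
  apply: (rt_trans _ _ _ [:: 0; 1; (c - 4).+2; 0; 0]); apply: rt_step.
    by apply: (step_left [:: 0]).
  by apply: (step_right [:: 0; 1]).
(* The first three vertices are among the first [m], so that the two ends
   together cover the whole path: too few pebbles in total. *)
- have := sumn_take_le s 3 m.+3 isT; have := psi_path_le m.+3.
  move: le_s; rewrite (sumn_take_drop s 3).
  rewrite [psi_path m.+3.+3]/= -/(psi_path m.+3) expnS.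
  move: (psi_path m.+3) (2 ^ m.+3) lt_l lt_r => p q; lia.
Qed.

(** * The lower bound *)

Definition weight (s : seq nat) : nat :=
  \sum_(i < size s) nth 0 s i * 2 ^ (size s - i.+1).

Lemma weight_cons x s : weight (x :: s) = x * 2 ^ size s + weight s.
Proof. by rewrite /weight big_ord_recl subn1. Qed.

(** The first entries are the heavy ones.  To dominate the first vertex, one of
    the first two must be occupied.  An occupied first vertex, or occupied
    second and third vertices, already weigh enough by [psi_path_le].
    Otherwise the third vertex is empty and does not help the sequence after
    it, which must therefore dominate itself. *)
Lemma dominated_weight s : dominated s -> psi_path (size s) <= weight s.
Proof.
move: {-1}(size s) (erefl (size s)) => n.
elim/ltn_ind: n s => -[|[|[|m]]] IH s es ds //.
- case: s es ds => // x [] // _ /(_ 0 isT) /=.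
  by rewrite !weight_cons /= muln1; lia.
- case: s es ds => // x [|y []] // _ /(_ 0 isT) /=.
  by rewrite !weight_cons /=; lia.
case: s es ds => // x [|y [|z s]] //= [es] ds.
rewrite !weight_cons /= es !expnS.
have le_psi := psi_path_le m.
have [x0|x_gt0] := posnP x; last by nia.
have y_gt0 : 0 < y by have := ds 0 isT; rewrite /= x0 addn0.
have [z0|z_gt0] := posnP z; last by nia.
have ds' : dominated s by move=> i lt_i; have := ds i.+3 lt_i; rewrite /= z0.
have := IH m (leqW (leqW (leqnn m.+1))) s es ds'.
nia.
Qed.

(** A move trades two pebbles on [u] for one on [v], so it cannot increase a
    weighted count whose weights at most double along an edge. *)
Lemma reachable_weight (G : graph) (w : G -> nat) (C C' : configuration G) :
  (forall u v, adj u v -> w v <= 2 * w u) -> reachable C C' ->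
  \sum_v C' v * w v <= \sum_v C v * w v.
Proof.
move=> hw; elim=> [{}C {}C' [u [v [uv le2 ->]]]|//|C1 C2 C3 _ le1 _ le2].
  (* Comparing the two sums after adding the weight of the two pebbles taken
     from [u] avoids the subtraction. *)
  have pick z (F : G -> nat) : \sum_x (if x == z then F x else 0) = F z.
    by rewrite -big_mkcond big_pred1_eq.
  rewrite -(leq_add2r (2 * w u)).
  apply: leq_trans (leq_add (leqnn _) (hw _ _ uv)).
  rewrite -(pick u (fun x => 2 * w x)) -(pick v w) -!big_split /=.
  apply: leq_sum => x _; rewrite ffunE.
  by case: (eqVneq x u) => [->|_]; case: eqVneq => _; nia.
exact: leq_trans le2 le1.
Qed.

(** * From sequences to the path graph *)

Definition seq_conf n (s : seq nat) : configuration (path_graph n) :=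
  [ffun i : 'I_n => nth 0 s i].

Definition conf_seq n (C : configuration (path_graph n)) : seq nat :=
  [seq C i | i <- enum 'I_n].

Lemma size_conf_seq n (C : configuration (path_graph n)) :
  size (conf_seq n C) = n.
Proof. by rewrite size_map size_enum_ord. Qed.

Lemma nth_conf_seq n (C : configuration (path_graph n)) (i : 'I_n) :
  nth 0 (conf_seq n C) i = C i.
Proof. by rewrite (nth_map i) ?size_enum_ord // nth_ord_enum. Qed.

Lemma conf_seqK n (C : configuration (path_graph n)) :
  seq_conf n (conf_seq n C) = C.
Proof. by apply/ffunP=> i; rewrite ffunE nth_conf_seq. Qed.

Lemma sumn_conf_seq n (C : configuration (path_graph n)) :
  sumn (conf_seq n C) = num_pebbles C.
Proof. by rewrite sumnE big_map big_enum. Qed.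

Lemma dominatedP n (s : seq nat) : size s = n ->
  dominated s <-> dominating (support_set (seq_conf n s)).
Proof.
move=> es; split=> [ds|/forallP ds i].
  apply/forallP=> -[i lt_i]; rewrite inE ffunE /=.
  have [i_0|//] := posnP (nth 0 s i).
  apply/existsP; have := ds i; rewrite es => /(_ lt_i).
  have [i1_0|i1_gt0 _] := posnP (nth 0 s i.+1); last first.
    have lt_i1 : i.+1 < n.
      by rewrite ltnNge; apply/negP=> le_i; rewrite nth_default ?es in i1_gt0.
    by exists (Ordinal lt_i1); rewrite inE ffunE i1_gt0 /= /path_adj /= eqxx.
  rewrite i_0 i1_0 !addn0; case: i lt_i {i_0 i1_0} => // i lt_i /= gt0.
  exists (Ordinal (ltnW lt_i)).
  by rewrite inE ffunE gt0 /= /path_adj /= eqxx orbT.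
rewrite es => lt_i; have := ds (Ordinal lt_i); rewrite inE ffunE /=.
case/orP=> [gt0|/existsP[j]]; first by lia.
rewrite inE ffunE => /andP[gt0].
by case/orP=> /eqP /= e; [rewrite e; lia | rewrite -e /=; lia].
Qed.

(** Isolates the two entries changed by a move; the remaining term is the same
    before and after it. *)
Lemma nth_cat_pair (p q : seq nat) x y i :
  nth 0 (p ++ x :: y :: q) i =
  if i == size p then x else if i == (size p).+1 then y
  else nth 0 (p ++ 0 :: 0 :: q) i.
Proof.
rewrite !nth_cat; case: ltngtP => // [lt|gt|->]; last by rewrite subnn.
  by rewrite (ltn_eqF (leqW lt)).
case: eqVneq => [->|ne]; first by rewrite subSnn.
by have -> : i - size p = (i - size p - 2).+2 by lia.
Qed.

Lemma seq_conf_step n s t : size s = n -> step s t ->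
  pebbling_move (seq_conf n s) (seq_conf n t).
Proof.
move=> es st; case: st es => p a b q; rewrite size_cat /= => es.
all: have ltp : size p < n by lia.
all: have ltp1 : (size p).+1 < n by lia.
  exists (Ordinal ltp), (Ordinal ltp1); split.
  - by rewrite /= /path_adj eqxx.
  - by rewrite ffunE nth_cat_pair eqxx.
  - apply/ffunP=> i; rewrite !ffunE
      (nth_cat_pair _ _ a.+2 b) (nth_cat_pair _ _ a b.+1) -!val_eqE /=.
    by case: eqVneq => [->|_]; [rewrite (ltn_eqF (leqnn _)) | case: eqVneq]; lia.
exists (Ordinal ltp1), (Ordinal ltp); split.
- by rewrite /= /path_adj /= eqxx orbT.
- by rewrite ffunE nth_cat_pair /= (gtn_eqF (leqnn _)) eqxx.
- apply/ffunP=> i; rewrite !ffunE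
      (nth_cat_pair _ _ b a.+2) (nth_cat_pair _ _ b.+1 a) -!val_eqE /=.
  by case: eqVneq => [->|_]; [rewrite (ltn_eqF (leqnn _)) | case: eqVneq]; lia.
Qed.

Lemma reach_reachable n s t : size s = n -> reach s t ->
  reachable (seq_conf n s) (seq_conf n t).
Proof.
move=> es st; have [] // := clos_map _ _ step (@pebbling_move (path_graph n))
  (seq_conf n) (fun s => size s = n) _ s t st es.
move=> {st}s' t' es' st; split; first by rewrite (step_size _ _ st).
exact: seq_conf_step.
Qed.

Lemma always_coverable_psi n : always_coverable (path_graph n) (psi_path n).
Proof.
move=> C sum_C.
have [|t [Ct dt]] := seq_coverable_psi (conf_seq n C).
  by rewrite size_conf_seq sumn_conf_seq sum_C.
exists (seq_conf n t); split.
  rewrite -[C in reachable C]conf_seqK.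
  by apply: reach_reachable Ct; rewrite size_conf_seq.
by apply/dominatedP=> //; rewrite (reach_size _ _ Ct) size_conf_seq.
Qed.

Lemma psi_path_lower n m : 0 < n -> always_coverable (path_graph n) m ->
  psi_path n <= m.
Proof.
case: n => // n _ cov.
pose C : configuration (path_graph n.+1) :=
  [ffun i => if i == ord_max :> 'I_n.+1 then m else 0].
have pick (F : 'I_n.+1 -> nat) : \sum_i C i * F i = m * F ord_max.
  rewrite (bigD1 (ord_max : 'I_n.+1)) //= ffunE eqxx big1 ?addn0 // => i ne.
  by rewrite ffunE (negbTE ne).
have [|D [CD dD]] := cov C.
  rewrite /num_pebbles -[RHS]muln1 -(pick (fun=> 1)).
  by apply: eq_bigr => i _; rewrite muln1.
have := reachable_weight (path_graph n.+1)
  (fun i => 2 ^ (n.+1 - (i : 'I_n.+1).+1)) C D _ CD.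
rewrite pick subnn muln1 => le_m; apply: leq_trans (le_m _).
  have dom : dominated (conf_seq _ D).
    by apply/(dominatedP n.+1); rewrite ?size_conf_seq ?conf_seqK.
  have := dominated_weight _ dom; rewrite /weight size_conf_seq.
  move/leq_trans; apply; rewrite leq_eqVlt; apply/orP; left; apply/eqP.
  by apply: eq_bigr => i _; rewrite nth_conf_seq.
move=> u v /orP[] /eqP e; rewrite -expnS leq_pexp2l //.
all: have := ltn_ord u; have := ltn_ord v; lia.
Qed.

Local Open Scope ring_scope.

(** * The closed formula *)

Lemma psi_path_closed_form k alpha : (alpha < 3)%N ->
  (psi_path (alpha + 3 * k).+2)%:R =
    2%:R ^+ (alpha + 3 * k).+3 * ((1 - 8%:R ^- k.+1) / 7%:R)
    + (Num.floor (alpha%:R / 2%:R : rat))%:~R :> rat.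
Proof.
move=> lt3; elim: k => [|k IH].
  by case: alpha lt3 => [|[|[|]]] // _; apply/eqP; vm_compute.
have -> : (alpha + 3 * k.+1 = (alpha + 3 * k).+3)%N by lia.
rewrite [psi_path _]/= natrD natrX {}IH addrA; congr (_ + _).
have ne : (8%:R : rat) ^+ k.+1 != 0 by rewrite expf_neq0.
rewrite !(exprS 2%:R) [8%:R ^+ k.+2]exprS.
by field.
Qed.

Theorem theorem4 (n k alpha : nat) (hn : (3 <= n)%N) (halpha : (alpha < 3)%N)
    (hnk : (n - 2 = alpha + 3 * k)%N) :
  exists m : nat, is_psi (path_graph n) m /\
    m%:R = 2%:R ^+ n.+1 * ((1 - 8%:R ^- k.+1) / 7%:R)
           + (Num.floor (alpha%:R / 2%:R : rat))%:~R :> rat.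
Proof.
exists (psi_path n); split.
  split; first exact: always_coverable_psi.
  by move=> m; apply: psi_path_lower; lia.
have -> : n = (alpha + 3 * k).+2 by lia.
exact: psi_path_closed_form.
Qed.
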